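(* Let $\mathbb B$ be the $3$-regular (infinite) tree with distinguished vertex $o$, and let $\{M_b^{+},M_b^{-}\}_{b\in\mathbb B}$ be i.i.d. nonnegative random variables. If the common distribution $\mathcal L(M_o^+)=\mathcal L(M_o^-)$ is concentrated on the interval $[0.9,1.1]$, then there exist multiple (i.e. at least two distinct) locally $\xi_{\mathbb B}$-optimal markings.
   Context: A marking $\Psi$ assigns to each vertex $b\in\mathbb B$, carrying the weights $(M_b^+,M_b^-)$, a mark $M_b'\in\{0,+,-\}$, with $-(+)=-$ and $-(-)=+$. The score at $o$ is $$\xi_{\mathbb B}(\Psi)=\begin{cases}-\infty&\text{if }M_o'\ne0\text{ and }M_b'=-M_o'\text{ for some }b\sim o,\\ M_o^{M_o'}&\text{otherwise,}\end{cases}$$ with the convention $M_o^0=0$, where $b\sim o$ means that $b$ is adjacent to $o$; the score at any other vertex $b$ is defined in the same way with $b$ in place of $o$. For two markings $\psi,\psi'$ of the same weights, $\psi'\Delta_b\psi$ denotes the score at $b$ of $\psi'$ minus that of $\psi$ (with $-\infty-(-\infty)=0$). A marking $\psi$ is locally $\xi_{\mathbb B}$-optimal if $\sum_{b\in\mathbb B}\psi'\Delta_b\psi\le0$ for every marking $\psi'$ of the same weights that differs from $\psi$ at only finitely many vertices and satisfies $\sum_b(\psi'\Delta_b\psi)_+<\infty$. A random marking is locally optimal if this holds almost surely. *)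

(* Defs.v *)
From HB Require Import structures.
From mathcomp Require Import all_boot all_order all_algebra.
From mathcomp Require Import all_classical all_reals all_analysis.

Set Implicit Arguments.
Unset Strict Implicit.
Unset Printing Implicit Defensive.

Import Order.TTheory GRing.Theory Num.Theory.
Import numFieldNormedType.Exports.
Local Open Scope classical_set_scope.
Local Open Scope ring_scope.

Section Graph.
Variables (V : eqType) (e : rel V).

Definition regular (k : nat) : Prop :=
  forall x : V, exists s : seq V,
    [/\ uniq s, size s = k & forall y, (y \in s) = e x y].

Definition connected_graph : Prop :=
  forall x y : V, exists2 p : seq V, path e x p & last x p = y.

(* [ucycle e c] also holds for [:: x; y] when x and y are adjacent, whence the
   bound on the size. *)
Definition acyclic_graph : Prop :=
  forall c : seq V, ucycle e c -> (size c <= 2)%N.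

Definition tree : Prop :=
  [/\ symmetric e, irreflexive e, connected_graph & acyclic_graph].

(* For k >= 2 such a tree is automatically infinite as soon as V is inhabited,
   and it is unique up to isomorphism. *)
Definition regular_tree (k : nat) : Prop := tree /\ regular k.

End Graph.

Inductive mark : Type := MZero | MPlus | MMinus.

Definition mopp (m : mark) : mark :=
  match m with MZero => MZero | MPlus => MMinus | MMinus => MPlus end.

Section Score.
Variables (R : realType) (V : choiceType) (e : rel V).
Variables wp wm : V -> R.

Definition mark_weight (b : V) (m : mark) : R :=
  match m with MZero => 0 | MPlus => wp b | MMinus => wm b end.

Definition score (psi : V -> mark) (b : V) : \bar R :=
  if `[< psi b <> MZero /\ exists2 c, e b c & psi c = mopp (psi b) >] then -oo%E
  else (mark_weight b (psi b))%:E.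

(* In \bar R, -oo - -oo evaluates to -oo; the convention here is that it is 0. *)
Definition score_diff (psi' psi : V -> mark) (b : V) : \bar R :=
  if (score psi' b == -oo%E) && (score psi b == -oo%E) then 0%E
  else (score psi' b - score psi b)%E.

(* [esum] is only meaningful for nonnegative terms, hence the signed sum is the
   sum of the positive parts (assumed finite) minus that of the negative
   parts. *)
Definition locally_optimal (psi : V -> mark) : Prop :=
  forall psi' : V -> mark,
    finite_set [set b | psi' b <> psi b] ->
    (\esum_(b in [set: V]) (score_diff psi' psi)^\+ b < +oo)%E ->
    (\esum_(b in [set: V]) (score_diff psi' psi)^\+ b
     - \esum_(b in [set: V]) (score_diff psi' psi)^\- b <= 0)%E.

End Score.

Section Random.
Variables (d : measure_display) (T : measurableType d) (R : realType).
Variable P : probability T R.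

Definition mutually_independent (I : eqType) (X : I -> {RV P >-> R}) : Prop :=
  forall (s : seq I) (A : I -> set R), uniq s ->
    (forall i, measurable (A i)) ->
    P (\big[setI/setT]_(i <- s) (X i @^-1` A i))
    = (\prod_(i <- s) P (X i @^-1` A i))%E.

Definition identically_distributed (I : Type) (X : I -> {RV P >-> R}) : Prop :=
  forall i j (A : set R), measurable A ->
    distribution P (X i) A = distribution P (X j) A.

Definition iid (I : eqType) (X : I -> {RV P >-> R}) : Prop :=
  mutually_independent X /\ identically_distributed X.

(* The two families M^+, M^- viewed as a single family of random variables. *)
Definition weight_family (V : choiceType) (Mp Mm : V -> {RV P >-> R})
    (i : V * bool) : {RV P >-> R} :=
  if i.2 then Mp i.1 else Mm i.1.

(* Measurability of T -> {0, +, -}^V, the mark set being discrete. *)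
Definition random_marking (V : choiceType) (Psi : T -> V -> mark) : Prop :=
  forall (b : V) (m : mark), measurable [set t | Psi t b = m].

Definition as_locally_optimal (V : choiceType) (e : rel V)
    (Mp Mm : V -> {RV P >-> R}) (Psi : T -> V -> mark) : Prop :=
  {ae P, forall t : T,
    locally_optimal e (fun b => Mp b t) (fun b => Mm b t) (Psi t)}.

End Random.

(* Main.v *)
Require Import Defs.
From HB Require Import structures.
From mathcomp Require Import all_boot all_order all_algebra.
From mathcomp Require Import all_classical all_reals all_analysis.
From mathcomp Require Import lra.

Import Order.TTheory GRing.Theory Num.Theory.
Import numFieldNormedType.Exports.
Local Open Scope classical_set_scope.
Local Open Scope ring_scope.

(** The two markings are the constant ones, all plus and all minus; they are
    deterministic, and almost surely both are locally optimal.

    Start from a constant nonzero mark m and change it at finitely many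
    vertices.  A change that creates a conflict costs an infinite amount, so
    consider a conflict-free one, with S the set of vertices that received the
    mark opposite to m and Z the set of those that received 0.  A vertex of S
    gains at most hi - lo = 0.2, because all weights lie in [lo, hi]; a vertex
    of Z loses at least lo = 0.9.  Since there is no conflict, every neighbour
    of S outside S lies in Z.  So the change can pay off only if the boundary
    of S is small compared with S, and in a regular tree it is not.

    The expansion estimate [forest_boundary] comes from counting edges.  A
    finite set S in a forest spans at most |S| edges (remove leaves one by
    one, [forest_leaf]), so at least k |S| - 2 |S| edges leave S, and a vertex
    of Z absorbs at most k of them: (k - 2) |S| <= k |Z|.  For k = 3 this gives
    |S| <= 3 |Z|, and the total change is at most 0.2 |S| - 0.9 |Z| <= 0
    ([constant_locally_optimal]).

    The bound on the weights has to hold at all vertices simultaneously, almost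
    surely; this is a countable intersection because a connected locally finite
    graph is countable ([locally_finite_enum]). *)

(** * Constant sums *)

Lemma sum_nat_const_seq {I : Type} (s : seq I) (c : nat) :
  (\sum_(i <- s) c = c * size s)%N.
Proof. by rewrite big_const_seq count_predT iter_addn_0. Qed.

Lemma sumr_const_seq {U : nmodType} {I : Type} (s : seq I) (c : U) :
  \sum_(i <- s) c = c *+ size s.
Proof. by rewrite big_const_seq count_predT iter_addr_0. Qed.

(** * Expansion in forests *)

(** If every vertex of S had two neighbours in S, a simple path inside S could
    always be prolonged: its first vertex has a neighbour in S other than the
    next vertex of the path, and that neighbour is not on the path since there
    are no cycles.  The path would outgrow S. *)
Lemma forest_leaf {V : eqType} {e : rel V} {S : seq V} :
  symmetric e -> irreflexive e -> acyclic_graph e -> uniq S -> S != [::] ->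
  exists2 x, x \in S & (count (e x) S <= 1)%N.
Proof.
move=> e_sym e_irr e_acyc uS S_neq0; apply: contrapT => no_leaf.
have grow x p : uniq (x :: p) -> path e x p -> x \in S ->
    exists2 y, y \in S & e y x && (y \notin x :: p).
  move=> up xp xS.
  (* For p empty, [head x p] is x itself, which is not a neighbour of x. *)
  have [y yS /andP[exy y_neq]] :
      exists2 y, y \in S & e x y && (y != head x p).
    apply: contrapT => no_y; apply: no_leaf; exists x => //.
    rewrite -size_filter -[1%N]/(size [:: head x p]).
    apply: uniq_leq_size; first exact: filter_uniq.
    move=> y; rewrite mem_filter inE => /andP[exy yS].
    by apply: contrapT => /negP y_neq; apply: no_y; exists y; rewrite ?exy.
  exists y; rewrite // e_sym exy inE negb_or /=; apply/andP; split.
    by apply: contraTneq exy => ->; rewrite e_irr.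
  apply/negP => yp; case/splitPr: yp up xp y_neq => p1 p2.
  (* y is not the head of p, so the cycle x, z :: p1, y has size at least 3. *)
  case: p1 => [|z p1] /=; first by rewrite eqxx.
  rewrite mem_cat cat_uniq /= !inE => up xp _.
  have /e_acyc : ucycle e [:: x, z & rcons p1 y]; last by rewrite /= size_rcons.
  move: up xp; rewrite /ucycle /= cat_path /=.
  rewrite rcons_path last_rcons rcons_path (e_sym y x) exy andbT.
  rewrite !inE mem_rcons !inE mem_rcons !inE rcons_uniq.
  move=> /and4P[xN zN up1 /andP[/norP[yp1 _] _]] /and4P[xz zp1 ly _].
  rewrite xz zp1 ly up1 yp1 !andbT /=; move: xN zN.
  rewrite mem_cat inE !negb_or.
  by move=> /and4P[-> -> -> _] /and3P[-> -> _].
have long n : exists x p,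
    [/\ uniq (x :: p), path e x p, {subset x :: p <= S} & size p = n].
  elim: n => [|n [x [p [up xp sp <-]]]].
    case: S S_neq0 {uS no_leaf grow} => // x S _; exists x, [::]; split => // y.
    by rewrite !inE => ->.
  have [y yS /andP[eyx yN]] := grow x p up xp (sp _ (mem_head _ _)).
  exists y, (x :: p); split; rewrite //= ?eyx //; first by rewrite yN.
  by move=> z; rewrite inE => /predU1P[->|/sp].
have [x [p [up _ sp szp]]] := long (size S).
by have := uniq_leq_size up sp; rewrite /= szp ltnn.
Qed.

(** The handshake bound: removing a leaf lowers the sum of the degrees by at
    most 2, one unit at the leaf and one at its neighbour. *)
Lemma forest_sum_degrees {V : eqType} {e : rel V} {S : seq V} :
  symmetric e -> irreflexive e -> acyclic_graph e -> uniq S ->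
  (\sum_(x <- S) count (e x) S <= 2 * size S)%N.
Proof.
move=> e_sym e_irr e_acyc.
have [n] := ubnP (size S); elim: n S => // n IHn S szS uS.
have [->|S_neq0] := eqVneq S [::]; first by rewrite big_nil.
have [x xS leaf] := forest_leaf e_sym e_irr e_acyc uS S_neq0.
have pS := perm_to_rem xS; set S' := rem x S in pS.
have uS' : uniq S' by exact: rem_uniq.
have szS' : size S = (size S').+1 by rewrite (perm_size pS).
have cntS y : count (e y) S = (e y x + count (e y) S')%N.
  by rewrite (permP pS).
have degx : count (e x) S = count (e x) S' by rewrite cntS e_irr.
rewrite (perm_big _ pS) big_cons /= -/S'.
under eq_bigr => y _ do rewrite cntS.
rewrite big_split /=.
have -> : (\sum_(y <- S') e y x = count (e x) S')%N.
  rewrite -sum1_count [RHS]big_mkcond; apply: eq_bigr => y _.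
  by rewrite e_sym; case: (e x y).
have := IHn S'; rewrite szS' in szS * => /(_ szS uS') IH.
by rewrite -degx addnA mulnS leq_add// -[2%N]addn1 leq_add.
Qed.

(** Double counting of the edges leaving S: by the handshake bound at least
    (k - 2) |S| edges do so, and each vertex of Z receives at most k of them.
    The inequality is arranged without truncated subtraction. *)
Lemma forest_boundary {V : eqType} {e : rel V} {k : nat} {S Z : seq V} :
  symmetric e -> irreflexive e -> acyclic_graph e -> regular e k ->
  uniq S -> uniq Z ->
  (forall x y, x \in S -> e x y -> (y \in S) || (y \in Z)) ->
  (k * size S <= 2 * size S + k * size Z)%N.
Proof.
move=> e_sym e_irr e_acyc e_reg uS uZ SZ.
have degU x : x \in S -> (k <= count (e x) S + count (e x) Z)%N.
  move=> xS; have [s [us <- sE]] := e_reg x.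
  rewrite -!size_filter -size_cat; apply: uniq_leq_size => // y.
  rewrite sE mem_cat !mem_filter => exy; rewrite exy /=; exact: SZ exy.
have degZ z : (count (e z) S <= k)%N.
  have [s [us <- sE]] := e_reg z.
  rewrite -size_filter; apply: uniq_leq_size; first exact: filter_uniq.
  by move=> y; rewrite mem_filter sE => /andP[].
have sum_degs : (k * size S <=
    \sum_(x <- S) count (e x) S + \sum_(x <- S) count (e x) Z)%N.
  rewrite -big_split /= -sum_nat_const_seq big_seq [leqRHS]big_seq.
  exact: leq_sum.
apply: (leq_trans sum_degs); apply: leq_add; first exact: forest_sum_degrees.
under eq_bigr do rewrite -sum1_count big_mkcond.
rewrite exchange_big /= -sum_nat_const_seq.
apply: leq_sum => z _; rewrite -big_mkcond /= (eq_bigl (e z)) ?sum1_count //.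
Qed.

(** * Countability *)

(** Fix an ordering of the neighbours of every vertex; a walk from o is then
    coded by the list of the ranks of its successive steps, and such lists are
    countable. *)
Lemma locally_finite_enum {V : eqType} {e : rel V} {k : nat} (o : V) :
  connected_graph e -> regular e k ->
  exists f : nat -> V, forall x, exists n, f n = x.
Proof.
move=> e_conn e_reg.
have [nb nbE] : exists nb : V -> seq V, forall x y, e x y -> y \in nb x.
  have /choice[nb nbE] : forall x, exists s : seq V, forall y, e x y -> y \in s.
    by move=> x; have [s [_ _ sE]] := e_reg x; exists s => y; rewrite sE.
  by exists nb.
pose walk := foldl (fun x i => nth o (nb x) i).
exists (fun n => walk o (odflt [::] (unpickle n))) => x.
suff [l <-] : exists l, walk o l = x by exists (pickle l); rewrite pickleK.
have [p + <-] := e_conn o x; elim: p (o) => [|z p IHp] y /=.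
  by exists [::].
move=> /andP[/nbE yz /IHp[l <-]]; exists (index z (nb y) :: l).
by rewrite /walk /= nth_index.
Qed.

(** * Signed sums with finite support *)

Lemma esum_seq (R : realType) (V : choiceType) (s : seq V) (f : V -> \bar R) :
  uniq s -> (forall b, 0 <= f b)%E -> (forall b, b \notin s -> f b = 0%E) ->
  (\esum_(b in [set: V]) f b = \sum_(b <- s) f b)%E.
Proof.
move=> us f_ge0 f0; rewrite fsbig_seq// -esum_fset; last 2 first.
- exact: finite_seq.
- by move=> b _; exact: f_ge0.
rewrite [RHS]esum_mkcond; apply: eq_esum => b _.
by rewrite mem_setE; case: ifPn => // /f0.
Qed.

Lemma esum_pos_sub_neg_seq (R : realType) (V : choiceType) (s : seq V)
    (g : V -> R) :
  uniq s -> (forall b, b \notin s -> g b = 0) ->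
  (\esum_(b in [set: V]) (EFin \o g)^\+ b
   - \esum_(b in [set: V]) (EFin \o g)^\- b = (\sum_(b <- s) g b)%:E)%E.
Proof.
move=> us g0; rewrite !(@esum_seq _ _ s) //.
- rewrite funerpos funerneg /= !sumEFin -EFinB -sumrB.
  congr (_%:E); apply: eq_bigr => b _.
  exact: (congr1 (@^~ b) (funrposBneg g)).
- by move=> b /g0 gb; rewrite funenegE /= gb oppr0 maxxx.
- by move=> b /g0 gb; rewrite funeposE /= gb maxxx.
Qed.

(** * Constant markings *)

Lemma nonzero_neq_mopp (m n : mark) :
  m <> MZero -> n <> MZero -> n <> m -> m = mopp n.
Proof. by case: m; case: n. Qed.

Lemma score_fin_num {R : realType} {V : choiceType} {e : rel V} {wp wm : V -> R}
    {psi : V -> mark} {b : V} :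
  score e wp wm psi b <> -oo%E ->
  score e wp wm psi b = (mark_weight wp wm b (psi b))%:E /\
  forall c, e b c -> psi b <> MZero -> psi c <> mopp (psi b).
Proof.
rewrite /score; case: asboolP => // nconf _; split=> // c ebc b0 c0.
by apply: nconf; split=> //; exists c.
Qed.

Lemma score_constant {R : realType} {V : choiceType} (e : rel V)
    (wp wm : V -> R) (m : mark) (b : V) :
  score e wp wm (fun=> m) b = (mark_weight wp wm b m)%:E.
Proof. by rewrite /score; case: asboolP => // -[m0 [c _]]; case: m m0. Qed.

(** The hypothesis [k%:R * (hi - lo) <= (k%:R - 2) * lo] is what the expansion
    estimate (k - 2) |S| <= k |Z| requires: the gain (hi - lo) |S| is then
    covered by the loss lo |Z|. *)
Lemma constant_locally_optimal {R : realType} {V : choiceType} {e : rel V}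
    {k : nat} {wp wm : V -> R} {m : mark} {lo hi : R} :
  tree e -> regular e k -> (0 < k)%N -> m <> MZero ->
  0 <= lo -> k%:R * (hi - lo) <= (k%:R - 2) * lo ->
  (forall b, lo <= wp b <= hi) -> (forall b, lo <= wm b <= hi) ->
  locally_optimal e wp wm (fun=> m).
Proof.
move=> [e_sym e_irr _ e_acyc] e_reg k_gt0 m0 lo_ge0 lohi wpE wmE psi' finA.
have w_bnd b n : n <> MZero -> lo <= mark_weight wp wm b n <= hi.
  by case: n => [/(_ erefl)|_|_] //=.
have [[b scb]|fin_sc] := pselect (exists b, score e wp wm psi' b = -oo%E).
  (* A conflict makes the sum of the negative parts infinite. *)
  move=> _.
  have -> : (\esum_(b in [set: V]) (score_diff e wp wm psi' (fun=> m))^\- b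
             = +oo)%E.
    apply/eqP; rewrite -leye_eq; apply: esum_ge; exists [set b] => //.
    by rewrite fsbig_set1 funenegE /score_diff score_constant scb.
  by rewrite addeNy leNye.
have score_eq b : score e wp wm psi' b = (mark_weight wp wm b (psi' b))%:E /\
    forall c, e b c -> psi' b <> MZero -> psi' c <> mopp (psi' b).
  by apply: score_fin_num => scb; apply: fin_sc; exists b.
pose g b := mark_weight wp wm b (psi' b) - mark_weight wp wm b m.
have diffE : score_diff e wp wm psi' (fun=> m) = EFin \o g.
  apply/funext => b; rewrite /score_diff score_constant (score_eq b).1 /=.
  by rewrite -EFinB.
move=> _; have [t tE] := (finite_seqP _).1 finA.
pose s := undup t.
have sE b : (b \in s) <-> psi' b <> m.
  by rewrite mem_undup; move: (congr1 (@^~ b) tE) => /= ->.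
rewrite diffE (@esum_pos_sub_neg_seq _ _ s) ?undup_uniq //; last first.
  move=> b /negP bs; rewrite /g; suff -> : psi' b = m by rewrite subrr.
  by apply: contrapT => /sE.
rewrite lee_fin.
pose isZ b := if psi' b is MZero then true else false.
have isZP b : reflect (psi' b = MZero) (isZ b).
  by apply: (iffP idP); rewrite /isZ; case: (psi' b).
set Z := [seq b <- s | isZ b]; set S := [seq b <- s | ~~ isZ b].
have bnd : (k * size S <= 2 * size S + k * size Z)%N.
  apply: forest_boundary => //; try by rewrite filter_uniq// undup_uniq.
  move=> x y; rewrite !mem_filter => /andP[/isZP x0 /sE xm] exy.
  have := (score_eq x).2 _ exy x0.
  have [y0 _|y0] /= := isZP y; rewrite ?orbF.
    by apply/sE; rewrite y0 => /esym.
  by move=> yx; apply/sE => ym; apply: yx; rewrite ym; exact: nonzero_neq_mopp.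
rewrite (bigID isZ) /= -!(big_filter _ isZ) -(big_filter _ (fun b => ~~ isZ b)).
rewrite -/S -/Z.
have leZ : \sum_(b <- Z) g b <= - lo * (size Z)%:R.
  rewrite mulr_natr -sumr_const_seq big_seq [leRHS]big_seq.
  apply: ler_sum => b; rewrite mem_filter /g => /andP[/isZP -> _].
  by rewrite /= sub0r lerN2; have /andP[] := w_bnd b m m0.
have leS : \sum_(b <- S) g b <= (hi - lo) * (size S)%:R.
  rewrite mulr_natr -sumr_const_seq big_seq [leRHS]big_seq.
  apply: ler_sum => b; rewrite mem_filter /g => /andP[/isZP b0 _].
  have /andP[_ ?] := w_bnd b _ b0; have /andP[? _] := w_bnd b m m0.
  exact: lerB.
apply: le_trans (lerD leZ leS) _.
have k0 : 0 < k%:R :> R by rewrite ltr0n.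
(* After multiplication by k, the bound is lohi times |S| plus lo times bndR. *)
rewrite -(ler_pM2l k0) mulr0.
have bndR : (k%:R * (size S)%:R <= 2 * (size S)%:R + k%:R * (size Z)%:R :> R).
  by rewrite -!natrM -natrD ler_nat.
have h1 := ler_wpM2r (ler0n R (size S)) lohi.
have h2 := ler_wpM2l lo_ge0 bndR.
lra.
Qed.

(** * Random weights *)

Lemma ae_weights {R : realType} {d : measure_display} {T : measurableType d}
    {P : probability T R} {X Y : {RV P >-> R}} {lo hi : R} :
  distribution P X `[lo, hi] = 1%E ->
  (forall A, measurable A -> distribution P X A = distribution P Y A) ->
  {ae P, forall t : T, lo <= Y t <= hi}.
Proof.
move=> PX XY; have PY : P (Y @^-1` `[lo, hi]) = 1%E by rewrite -PX XY.
have mY : measurable (Y @^-1` `[lo, hi]).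
  by rewrite -[_ @^-1` _]setTI; exact: measurable_funPT.
exists (~` (Y @^-1` `[lo, hi])); split.
- exact: measurableC.
- by rewrite probability_setC// PY subee.
- by apply: subsetC => t /=; rewrite in_itv.
Qed.

Theorem proposition2p8
  (R : realType) (d : measure_display) (T : measurableType d)
  (P : probability T R)
  (V : choiceType) (e : rel V) (o : V)
  (Htree : regular_tree e 3)
  (Mp Mm : V -> {RV P >-> R})
  (Hnonneg : forall b : V,
     {ae P, forall t : T, 0 <= Mp b t} /\ {ae P, forall t : T, 0 <= Mm b t})
  (Hiid : iid (weight_family Mp Mm))
  (Hconc : distribution P (Mp o) `[9%:R / 10%:R, 11%:R / 10%:R] = 1%E) :
  exists Psi1 Psi2 : T -> V -> mark,
    [/\ random_marking Psi1 /\ random_marking Psi2,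
        as_locally_optimal e Mp Mm Psi1,
        as_locally_optimal e Mp Mm Psi2
      & {ae P, forall t : T, Psi1 t <> Psi2 t}].
Proof.
have [tree_e reg_e] := Htree.
have [_ _ conn_e _] := tree_e.
have [_ same_law] := Hiid.
pose lo : R := 9%:R / 10%:R; pose hi : R := 11%:R / 10%:R.
have aeM i : {ae P, forall t, lo <= weight_family Mp Mm i t <= hi}.
  by apply: (ae_weights Hconc) => A; exact: (same_law (o, true) i A).
have [f f_surj] := locally_finite_enum o conn_e reg_e.
have ae_all i :
    {ae P, forall t, forall b, lo <= weight_family Mp Mm (b, i) t <= hi}.
  have := ae_foralln (fun n => aeM (f n, i)).
  by apply: filterS => t h b; have [n <-] := f_surj b; exact: h.
have opt m : m <> MZero -> as_locally_optimal e Mp Mm (fun=> fun=> m).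
  move=> m0; rewrite /as_locally_optimal.
  apply: (filterS2 _ _ (ae_all true) (ae_all false)) => t hp hm.
  apply: (@constant_locally_optimal _ _ _ 3 _ _ _ lo hi) => //;
    rewrite /lo /hi; lra.
have meas_const m : random_marking (fun _ : T => fun _ : V => m).
  move=> b n; have [->|mn] := pselect (m = n).
    by rewrite (_ : [set _ | _] = setT)//; apply/seteqP; split.
  by rewrite (_ : [set _ | _] = set0)//; apply/seteqP; split.
exists (fun=> fun=> MPlus), (fun=> fun=> MMinus); split => //.
- exact: opt.
- exact: opt.
- by apply: aeW => t /(congr1 (@^~ o)).
Qed.
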